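(* Let $T$ be a directed tree. The maps $L:\mathcal J(T)\to\mathcal I(T)$ and $U_\partial:\mathcal I(T)\to\mathcal J(T)$, between the open subsets of $\partial T$ and the invariants of $T$, are inverses of each other.
   Context: A graph $T$ consists of a set $T^0$ of vertices, a set $T^1$ of edges, maps $o,t:T^1\to T^0$, and a reversal $e\mapsto\overline e$ on $T^1$ with $\overline{\overline e}=e$, $\overline e\ne e$, $o(\overline e)=t(e)$. A directed graph is a graph with a subset $T^1_+\subseteq T^1$ containing exactly one edge from each pair $\{e,\overline e\}$. (No finiteness or countability assumptions.) A path is a finite or infinite sequence $e_1e_2\cdots$ of edges with $t(e_{i-1})=o(e_i)$ and $e_i\ne\overline{e_{i-1}}$ for $i>1$; vertices are paths of length $0$; it is directed if all $e_i\in T^1_+$ (length-zero paths are directed). $T^*$: finite paths; $T^*_+$, $T^\infty_+$: finite, infinite directed paths. $T$ is a tree if for all $u,v\in T^0$ there is a unique $p\in T^*$ with $o(p)=u$, $t(p)=v$. For $v\in T^0$: $\Delta_1(v)=\{e\in T^1_+: o(e)=v\}$, $V(v)=\{t(p):p\in T^*_+,\,o(p)=v\}$, and for finite $F\subseteq\Delta_1(v)$, $V(v;F)=\{v\}\cup\bigcup_{e\in\Delta_1(v)\setminus F}V(t(e))$. $\Omega(T)=\{u:\Delta_1(u)=\emptyset\}$, $\Sigma(T)=\{u:0<\#\Delta_1(u)<\infty\}$. $\mathcal A(T)$ is the ring of subsets of $T^0$ consisting of finite disjoint unions of sets $V(v;F)$ and $\emptyset$; $A(T)\subseteq\ell^\infty(T^0)$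 is the closed linear span of $\{\chi_B:B\in\mathcal A(T)\}$. Its spectrum $A(T)^\wedge$ is the set of $\mathcal A(T)$-ultrafilters, identified with $T^0\cup(T^\infty_+/\!\sim)$: $v\in T^0$ corresponds to $\{B:v\in B\}$, the class of $p=e_1e_2\cdots\in T^\infty_+$ to $\{B:V(o(e_j))\subseteq B\text{ for some }j\}$; $p\sim q$ iff some tail of $p$ equals some tail of $q$. The boundary $\partial T$ is the closure of $\Omega(T)\cup(T^\infty_+/\!\sim)$ in $A(T)^\wedge$. For $B\in\mathcal A(T)$, $[B]$ is the set of ultrafilters containing $B$, and $[B]_\partial=[B]\cap\partial T$. An invariant of a directed graph $T$ is a pair $(N,F)$ of a subset $N\subseteq T^0$ and a family $\{F_u:u\in N\}$ of finite sets $F_u\subseteq\Delta_1(u)$ such that: (i) if $u\in N$ and $\Delta_1(u)$ is finite then $F_u=\emptyset$; (ii) for $u\in N$, $e\in\Delta_1(u)$: (a) if $e\notin F_u$ then $t(e)\in N$ and $F_{t(e)}=\emptyset$; (b) if $e\in F_u$ and $t(e)\in N$ then $F_{t(e)}\ne\emptyset$; (iii) if $u\in T^0$, $\Delta_1(u)$ is finite and nonempty, $t(\Delta_1(u))\subseteq N$ and $F_{t(e)}=\emptyset$ for all $e\in\Delta_1(u)$, then $u\in N$. $\mathcal I(T)$ is the set of invariants. $\mathcal J(T)$ is the set of open subsets of $\partial T$. Define $U_\partial(N,F)=\bigcup_{u\in N}[V(u;F_u)]_\partial$. Define $L(W)=(N,F)$, where $N=\{u\in T^0\setminus\Sigma(T):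 \exists\, F\subseteq\Delta_1(u)\text{ finite with }[V(u;F)]_\partial\subseteq W\}\cup\{u\in T^0:[V(u)]_\partial\subseteq W\}$ and, for $u\in N$, $F_u=\bigcap\{F\subseteq\Delta_1(u)\text{ finite}:[V(u;F)]_\partial\subseteq W\}$. (These maps are well defined.) *)

(* Defs.v *)
From HB Require Import structures.
From Stdlib Require List.
From mathcomp Require Import all_boot all_classical topology.

Set Implicit Arguments.
Unset Strict Implicit.
Unset Printing Implicit Defensive.

Local Open Scope classical_set_scope.

Record graph := Graph {
  vertex : Type;
  edge : Type;
  org : edge -> vertex;
  tgt : edge -> vertex;
  rev : edge -> edge;
  rev_invol : forall e, rev (rev e) = e;
  rev_neq : forall e, rev e <> e;
  org_rev : forall e, org (rev e) = tgt e }.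

Record digraph := Digraph {
  ugraph :> graph;
  pos : set (edge ugraph);
  pos_rev : forall e, pos (rev e) <-> ~ pos e }.

Section Paths.
Variable T : graph.

Fixpoint walk (u : vertex T) (p : seq (edge T)) (v : vertex T) : Prop :=
  if p is e :: p' then org e = u /\ walk (tgt e) p' v else u = v.

Fixpoint reduced (p : seq (edge T)) : Prop :=
  if p is e :: p' then
    (if p' is e' :: _ then e' <> rev e else True) /\ reduced p'
  else True.

Definition is_path u p v := walk u p v /\ reduced p.

Definition is_tree := forall u v : vertex T, exists! p, is_path u p v.

Definition is_infpath (p : nat -> edge T) :=
  forall i, tgt (p i) = org (p i.+1) /\ p i.+1 <> rev (p i).

End Paths.

Section RingFilters.
Variables (X : Type) (A : set (set X)).

(* [A] is a ring of subsets of [X] that need not contain [setT], so these are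
   not filters on [X] in the sense of the library. *)
Definition ring_filter (U : set (set X)) :=
  [/\ U `<=` A, U !=set0, ~ U set0,
      (forall B C, U B -> U C -> U (B `&` C)) &
      (forall B C, A C -> U B -> B `<=` C -> U C)].

Definition ring_ultrafilter (U : set (set X)) :=
  ring_filter U /\ forall U', ring_filter U' -> U `<=` U' -> U' = U.

End RingFilters.

Section DirectedGraph.
Variable T : digraph.

Definition Delta1 (v : vertex T) : set (edge T) :=
  [set e | pos e /\ org e = v].

Definition Vset (v : vertex T) : set (vertex T) :=
  [set w | exists2 p, is_path v p w & List.Forall (@pos T) p].

Definition VsetF (v : vertex T) (F : set (edge T)) : set (vertex T) :=
  [set v] `|` \bigcup_(e in Delta1 v `\` F) Vset (tgt e).

Definition Omega : set (vertex T) := [set u | Delta1 u = set0].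

Definition Sigma : set (vertex T) :=
  [set u | Delta1 u !=set0 /\ finite_set (Delta1 u)].

Definition fin_sub (v : vertex T) : set (set (edge T)) :=
  [set F | finite_set F /\ F `<=` Delta1 v].

(* The case [n = 0] gives the empty set. *)
Definition ringA : set (set (vertex T)) :=
  [set B | exists (n : nat) (v : 'I_n -> vertex T) (F : 'I_n -> set (edge T)),
    [/\ (forall i, fin_sub (v i) (F i)),
        trivIset setT (fun i => VsetF (v i) (F i)) &
        B = \bigcup_i VsetF (v i) (F i)]].

(* The Gelfand spectrum of the closed span of the [\chi_B], [B] in [ringA]: a
   character [phi] corresponds to the ultrafilter [{B | phi \chi_B = 1}], and
   the weak-* topology to the one with base the sets [cyl B] below. *)
Record spectrum := Spectrum {
  ufam :> set (set (vertex T));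
  ufamP : ring_ultrafilter ringA ufam }.

HB.instance Definition _ := gen_eqMixin spectrum.
HB.instance Definition _ := gen_choiceMixin spectrum.

Definition cyl (B : set (vertex T)) : set spectrum := [set x | ufam x B].

Lemma cyl_cover : \bigcup_(B in ringA) cyl B = setT.
Proof.
apply/seteqP; split=> // x _.
by have [[sUA [B xB] _ _ _] _] := ufamP x; exists B => //; exact: sUA.
Qed.

Lemma cyl_join B C x : ringA B -> ringA C -> cyl B x -> cyl C x ->
  exists D, [/\ ringA D, cyl D x & cyl D `<=` cyl B `&` cyl C].
Proof.
move=> AB AC xB xC; have [[sUA _ _ UI _] _] := ufamP x.
have xBC := UI _ _ xB xC; exists (B `&` C); split=> //; first exact: sUA.
move=> y yBC; have [[_ _ _ _ Uup] _] := ufamP y.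
by split; [apply: Uup AB yBC _ | apply: Uup AC yBC _] => z [].
Qed.

HB.instance Definition _ :=
  isBaseTopological.Build spectrum cyl_cover cyl_join.

Definition vertex_family (v : vertex T) : set (set (vertex T)) :=
  [set B | ringA B /\ B v].

(* Tail-equivalent paths have the same family, so the quotient of the set of
   infinite directed paths does not have to be formed. *)
Definition path_family (p : nat -> edge T) : set (set (vertex T)) :=
  [set B | ringA B /\ exists j, Vset (org (p j)) `<=` B].

Definition boundary : set spectrum :=
  closure ([set x | exists2 v, Omega v & ufam x = vertex_family v] `|`
           [set x | exists p, [/\ is_infpath p, (forall i, pos (p i)) &
                                  ufam x = path_family p]]).

Definition bcyl (B : set (vertex T)) : set spectrum := cyl B `&` boundary.

(* Open subsets of the subspace [boundary], as subsets of the spectrum. *)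
Definition openJ : set (set spectrum) :=
  [set W | exists2 O, open O & W = O `&` boundary].

(* A family [{F_u : u in N}] is encoded as a total function that is empty
   off [N], so that equality of pairs is equality of the families. *)
Definition invI : set (set (vertex T) * (vertex T -> set (edge T))) :=
  [set NF | let: (N, F) := NF in
    (forall u, ~ N u -> F u = set0) /\
    [/\ (forall u, N u -> fin_sub u (F u)),
        (forall u, N u -> finite_set (Delta1 u) -> F u = set0),
        (forall u e, N u -> Delta1 u e -> ~ F u e ->
           N (tgt e) /\ F (tgt e) = set0),
        (forall u e, N u -> Delta1 u e -> F u e ->
           N (tgt e) -> F (tgt e) <> set0) &
        (forall u, finite_set (Delta1 u) -> Delta1 u !=set0 ->
           (forall e, Delta1 u e -> N (tgt e) /\ F (tgt e) = set0) -> N u)]].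

Definition Ubd (NF : set (vertex T) * (vertex T -> set (edge T))) :
    set spectrum :=
  \bigcup_(u in NF.1) bcyl (VsetF u (NF.2 u)).

Definition LN (W : set spectrum) : set (vertex T) :=
  [set u | ~ Sigma u /\ exists2 F, fin_sub u F & bcyl (VsetF u F) `<=` W] `|`
  [set u | bcyl (Vset u) `<=` W].

Definition LF (W : set spectrum) (u : vertex T) : set (edge T) :=
  [set e | LN W u /\
     forall F, fin_sub u F -> bcyl (VsetF u F) `<=` W -> F e].

Definition Lmap (W : set spectrum) :
    set (vertex T) * (vertex T -> set (edge T)) := (LN W, LF W).

End DirectedGraph.

Arguments openJ T : clear implicits.
Arguments invI T : clear implicits.
Arguments Lmap T W : clear implicits.
Arguments Ubd T NF : clear implicits.

(* Main.v *)
(* The sets [VsetF v F] are closed under nonempty intersections because two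
   directed walks with a common end merge once, at a vertex determined by the
   geodesic between their starting points.  Hence membership of a finite union
   in an ultrafilter passes to one of its pieces, which gives
   [Ubd (Lmap W) = W] and the axioms of an invariant for [Lmap W].  For
   [Lmap (Ubd (N, F)) = (N, F)], suppose [bcyl (Vset u)] is covered by
   [Ubd (N, F)] but [u] is not in [N] with [F u] empty.  By the axioms some edge
   leads to a vertex with the same defect, and so on; the end of the resulting
   infinite path is a boundary point that [Ubd (N, F)] fails to cover. *)

Require Import Defs.
From mathcomp Require Import all_boot all_classical topology.

Set Implicit Arguments.
Unset Strict Implicit.
Unset Printing Implicit Defensive.

Local Open Scope classical_set_scope.

(** [rev] alone denotes reversal of sequences here; [back p] is the path [p] traversed backwards. *)
Local Notation bar := Defs.rev.
Local Notation back p := (rev (map (@bar _) p)).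

(** * Concatenation and reversal of walks *)

Section Walks.
Variable T : graph.
Implicit Types (u v w : vertex T) (e f : edge T) (p q : seq (edge T)).

Lemma tgt_bar e : tgt (bar e) = org e.
Proof. by rewrite -org_rev rev_invol. Qed.

Lemma walk_cat u v w p q : walk u p v -> walk v q w -> walk u (p ++ q) w.
Proof.
elim: p u => [|e p IH] u /=; first by move=> ->.
by move=> [? pv] qw; split=> //; apply: IH.
Qed.

Lemma walk_back u p v : walk u p v -> walk v (back p) u.
Proof.
elim: p u => [|e p IH] u /=; first by move->.
move=> [<- /IH pv]; rewrite rev_cons -cats1; apply: walk_cat pv _.
by rewrite /= org_rev tgt_bar.
Qed.

Lemma reduced_cat p e f q : reduced (rcons p e) -> reduced (f :: q) ->
  f <> bar e -> reduced (rcons p e ++ f :: q).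
Proof.
move=> + rq fe; elim: p => [|g p IH] //=.
by move=> [gp /IH rp]; split=> //; case: p gp {IH rp}.
Qed.

Lemma reduced_back p : reduced p -> reduced (back p).
Proof.
elim: p => [|e [|f p] IH] //= [fe /IH].
rewrite /= !rev_cons -(cats1 _ (bar e)) => rp.
by apply: reduced_cat => //; rewrite rev_invol => ef; apply: fe; rewrite ef.
Qed.

End Walks.

(** * Directed walks and the sets [VsetF u F] *)

Section DirectedWalks.
Variable T : digraph.
Implicit Types (u v w x y m : vertex T) (e f : edge T) (p q a b c : seq (edge T)).

(** Reducedness is automatic: the reverse of a positive edge is not positive ([dwalk_path]). *)
Fixpoint dwalk u p v : Prop :=
  if p is e :: p' then Delta1 u e /\ dwalk (tgt e) p' v else u = v.

Lemma dwalk_walk u p v : dwalk u p v <-> walk u p v /\ List.Forall (@pos T) p.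
Proof.
elim: p u => [|e p IH] u /=.
  by split=> [->|[]//]; split=> //; constructor.
split=> [[[ep <-] /IH[pv Pp]]|[[<- pv] Pp]]; first by do !split=> //; constructor.
by inversion_clear Pp; do !split=> //; apply/IH.
Qed.

Lemma dwalk_path u p v : dwalk u p v -> is_path u p v.
Proof.
move=> dp; split; first by case/dwalk_walk: dp.
elim: p u dp => [|e p IH] u //= [[ep _] dp]; split; last exact: IH dp.
by case: p dp {IH} => //= f p [[fp _] _] fe; move: fp; rewrite fe pos_rev.
Qed.

Lemma VsetP u v : Vset u v <-> exists p, dwalk u p v.
Proof.
split=> [[p [pv _] Pp]|[p pv]]; first by exists p; apply/dwalk_walk.
by exists p; [exact: dwalk_path pv | case/dwalk_walk: pv].
Qed.

Lemma dwalk_cat u p q w :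
  dwalk u (p ++ q) w <-> exists2 v, dwalk u p v & dwalk v q w.
Proof.
elim: p u => [|e p IH] u /=; first by split=> [|[v ->]//]; exists u.
split=> [[ue /IH[v pv qw]]|[v [ue pv] qw]]; first by exists v.
by split=> //; apply/IH; exists v.
Qed.

Lemma dwalk_rcons u p e v :
  dwalk u (rcons p e) v <-> dwalk u p (org e) /\ (pos e /\ tgt e = v).
Proof.
rewrite -cats1 dwalk_cat; split; first by move=> [w pw /= [[? ->] ?]].
by move=> [pe [ep ev]]; exists (org e).
Qed.

Lemma dwalk_back_head u p v e q : dwalk u p v -> back p = e :: q -> ~ pos e.
Proof.
case/lastP: p => [|p f] //= /dwalk_rcons[_ [fp _]].
by rewrite map_rcons rev_rcons => -[<- _]; rewrite pos_rev.
Qed.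

(* Stripping the longest common suffix leaves a geodesic from [v] to [w] that
   runs forwards along [a] and then backwards along [b]. *)
Lemma dwalk_merge v p w q x : dwalk v p x -> dwalk w q x ->
  exists m a b c, [/\ p = a ++ c, q = b ++ c, dwalk v a m, dwalk w b m &
                      dwalk m c x /\ is_path v (a ++ back b) w].
Proof.
elim/last_ind: p x q => [|p e IH] x q vx wx.
  move: (vx) => /= vx'; exists x, [::], q, [::]; rewrite !cats0; split=> //.
  split=> //=; have [wq rq] := dwalk_path wx.
  by rewrite {1}vx'; split; [exact: walk_back | exact: reduced_back].
case/lastP: q wx => [|q f] wx.
  exists x, (rcons p e), [::], [::]; rewrite !cats0; split=> //; split=> //=.
  by move: wx => /= ->; exact: dwalk_path.
have [ef|nef] := pselect (e = f).
  move: vx wx => /dwalk_rcons[pe [e_pos ex]] /dwalk_rcons[].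
  rewrite -ef => qe _; have [m [a [b [c [-> -> va wb [mc ab]]]]]] := IH _ _ pe qe.
  exists m, a, b, (rcons c e); rewrite !rcons_cat; split=> //; split=> //.
  exact/dwalk_rcons.
exists x, (rcons p e), (rcons q f), [::]; rewrite !cats0; split=> //.
have [wp rp] := dwalk_path vx; have [wq rq] := dwalk_path wx.
split=> //; split; first exact: walk_cat (walk_back wq).
move/reduced_back: rq; rewrite map_rcons rev_rcons => rq.
by apply: reduced_cat => // bfe; apply: nef; rewrite -[e]rev_invol -bfe rev_invol.
Qed.

(** All edges of [a] are positive and none of [back b] is, so the change of sign marks the turn. *)
Lemma turn_unique v a m a' m' w b b' : dwalk v a m -> dwalk v a' m' ->
  dwalk w b m -> dwalk w b' m' -> a ++ back b = a' ++ back b' ->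
  a = a' /\ b = b'.
Proof.
elim: a a' v => [|e a IH] [|e' a'] v /=.
- move=> _ _ _ _ /(congr1 rev); rewrite !revK => bb'; split=> //.
  by apply: (inj_map _ bb'); apply: can_inj (@rev_invol T).
- by move=> _ [[e'_pos _] _] wb _ /(dwalk_back_head wb).
- by move=> [[e_pos _] _] _ _ wb' /esym/(dwalk_back_head wb').
- move=> [_ va] [_ va'] wb wb' [ee' aa']; rewrite -ee' in va' *.
  by have [-> ->] := IH _ _ va va' wb wb' aa'.
Qed.

Lemma Vset_refl v : Vset v v.
Proof. by apply/VsetP; exists [::]. Qed.

Lemma Vset_trans u v : Vset u v -> Vset v `<=` Vset u.
Proof.
move=> /VsetP[p pv] w /VsetP[q qw]; apply/VsetP; exists (p ++ q).
by apply/dwalk_cat; exists v.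
Qed.

Lemma Vset_edge u e : Delta1 u e -> Vset u (tgt e).
Proof. by move=> ue; apply/VsetP; exists [:: e]. Qed.

(** Only the first edge is tested; the trivial walk passes because [u] lies in [VsetF u F]. *)
Definition avoids (F : set (edge T)) p := if p is e :: _ then ~ F e else True.

Lemma VsetFP u F v : VsetF u F v <-> exists2 p, dwalk u p v & avoids F p.
Proof.
split=> [[->|[e [ue Fe] /VsetP[p pv]]]|[[|e p] /=]]; first by exists [::].
- by exists (e :: p).
- by move=> -> _; left.
- by move=> [ue pv] Fe; right; exists e => //; apply/VsetP; exists p.
Qed.

Lemma VsetF0 u : VsetF u set0 = Vset u.
Proof.
apply/seteqP; split=> v; first by move=> /VsetFP[p pv _]; apply/VsetP; exists p.
by move=> /VsetP[p pv]; apply/VsetFP; exists p => //; case: p {pv} => //= e p [].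
Qed.

Lemma VsetF_refl u F : VsetF u F u.
Proof. by left. Qed.

Lemma VsetFS u F G : F `<=` G -> VsetF u G `<=` VsetF u F.
Proof.
move=> FG v [->|[e [ue Ge] ev]]; first by left.
by right; exists e => //; split=> // /FG/Ge.
Qed.

Lemma sub_VsetF u F e : Delta1 u e -> ~ F e -> Vset (tgt e) `<=` VsetF u F.
Proof. by move=> ue Fe v ev; right; exists e. Qed.

Lemma VsetF_Vset u F v : VsetF u F v -> v <> u -> Vset v `<=` VsetF u F.
Proof.
move=> [//|[e [ue Fe] ev]] _; apply: subset_trans (sub_VsetF ue Fe).
exact: Vset_trans.
Qed.

Lemma VsetF_Delta1 u : VsetF u (Delta1 u) = [set u].
Proof. by apply/seteqP; split=> [v [//|[e []]]|v ->]; last left. Qed.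

Lemma fin_sub0 u : fin_sub u (@set0 (edge T)).
Proof. by split. Qed.

End DirectedWalks.

(** * Intersections of the sets [VsetF] in a tree *)

Section DirectedTree.
Variables (T : digraph) (treeT : is_tree T).
Implicit Types (u v w x y m : vertex T) (e f : edge T) (p q a b c : seq (edge T)).

Lemma dwalk_unique u p q v : dwalk u p v -> dwalk u q v -> p = q.
Proof.
move=> /dwalk_path pv /dwalk_path qv.
by have [r [_ rU]] := treeT u v; rewrite -(rU p) // -(rU q).
Qed.

Lemma tgt_neq u e : Delta1 u e -> tgt e <> u.
Proof.
move=> ue eu; have : [:: e] = [::] by apply: (@dwalk_unique u _ _ u).
by [].
Qed.

(** The same [m], [a], [b] serve every common end [y]: [a ++ back b] is the unique path from [v] to
    [w], and [turn_unique] recovers both halves from it. *)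
Lemma Vset_meet v w x : Vset v x -> Vset w x ->
  exists m a b, [/\ dwalk v a m, dwalk w b m &
    forall y p q, dwalk v p y -> dwalk w q y ->
      exists c, [/\ p = a ++ c, q = b ++ c & dwalk m c y]].
Proof.
move=> /VsetP[p px] /VsetP[q qx].
have [m [a [b [_ [_ _ va wb [_ ab]]]]]] := dwalk_merge px qx.
exists m, a, b; split=> // y p' q' py qy.
have [m' [a' [b' [c [-> -> va' wb' [mc ab']]]]]] := dwalk_merge py qy.
have abE : a ++ back b = a' ++ back b'.
  by have [r [_ rU]] := treeT v w; rewrite -(rU _ ab) -(rU _ ab').
have [aa bb] := turn_unique va va' wb wb' abE; rewrite -aa -bb.
exists c; split=> //; suff -> : m = m' by [].
rewrite -aa in va'; elim: a v va va' {ab ab' abE aa px py} => [|e a IH] v /=.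
  by move=> <- <-.
by move=> [_ va] [_ va']; exact: IH va va'.
Qed.

Lemma avoids_cat F a c d : avoids F (a ++ d) ->
  avoids F (a ++ c) <-> avoids (if a is [::] then F else set0) c.
Proof. by case: a => [|e a] //= Fe; split=> // _; case: c => //= f c []. Qed.

Lemma VsetFI v F w G : fin_sub v F -> fin_sub w G ->
  VsetF v F `&` VsetF w G !=set0 ->
  exists m H, fin_sub m H /\ VsetF v F `&` VsetF w G = VsetF m H.
Proof.
move=> finF finG [x [/VsetFP[p px Fp] /VsetFP[q qx Gq]]].
have vx : Vset v x by apply/VsetP; exists p.
have wx : Vset w x by apply/VsetP; exists q.
have [m [a [b [va wb meet]]]] := Vset_meet vx wx.
have [d [pE qE md]] := meet _ _ _ px qx; rewrite pE in Fp; rewrite qE in Gq.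
(* The restriction [F] survives at [m] only if [a] is empty, and then [m] is [v]; otherwise the
   first edge of [a] has already passed the test. Likewise for [G] and [b]. *)
exists m, ((if a is [::] then F else set0) `|` (if b is [::] then G else set0)).
have avoidsU A B c : avoids (A `|` B) c <-> avoids A c /\ avoids B c.
  case: c => //= e c; split=> [AB|[? ?] []//].
  by split=> ?; apply: AB; [left|right].
split.
  suff H (u0 : vertex T) (H0 : set (edge T)) c : fin_sub u0 H0 -> dwalk u0 c m ->
      fin_sub m (if c is [::] then H0 else set0).
    have [Ha Hb] := (H _ _ _ finF va, H _ _ _ finG wb).
    split; first by rewrite finite_setU; split; [exact: Ha.1|exact: Hb.1].
    by rewrite subUset; split; [exact: Ha.2|exact: Hb.2].
  by case: c => [|e c] finH /=; [move=> <- | move=> _; exact: fin_sub0].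
apply/seteqP; split=> y.
  move=> [/VsetFP[p' py Fp'] /VsetFP[q' qy Gq']].
  have [c [p'E q'E mc]] := meet _ _ _ py qy; apply/VsetFP; exists c => //.
  apply/avoidsU; split; first by apply/(avoids_cat c Fp); rewrite -p'E.
  by apply/(avoids_cat c Gq); rewrite -q'E.
move=> /VsetFP[c mc /avoidsU[/(avoids_cat c Fp) Fc /(avoids_cat c Gq) Gc]].
by split; apply/VsetFP; [exists (a ++ c) | exists (b ++ c)] => //;
  apply/dwalk_cat; exists m.
Qed.

End DirectedTree.

(** * Filters and ultrafilters of a ring of sets *)

Section RingFilterTheory.
Variables (X : Type) (A : set (set X)).
Implicit Types (U D : set (set X)) (B C G : set X).

Lemma ring_filter_disjoint U D : ring_filter A U -> finite_set D ->
  (forall B, D B -> exists2 C, U C & C `&` B = set0) ->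
  exists2 C, U C & C `&` \bigcup_(B in D) B = set0.
Proof.
move=> [_ [C0 UC0] _ UI _] /finite_seqP[s ->] sep.
have : forall B, B \in s -> exists2 C, U C & C `&` B = set0 by [].
elim: s {sep} => [|B s IH] sep.
  by exists C0 => //; apply/seteqP; split=> // x [_ [B]].
have [|C UC Cs] := IH; first by move=> B' sB'; apply: sep; rewrite inE sB' orbT.
have [|G UG GB] := sep B; first by rewrite inE eqxx.
exists (C `&` G); first exact: UI.
apply/seteqP; split=> // x [[Cx Gx] [B' /=]]; rewrite inE => /orP[/eqP->|sB'] B'x.
  by have : (G `&` B) x by []; rewrite GB.
have : (C `&` \bigcup_(B in [set` s]) B) x by split=> //; exists B'.
by rewrite Cs.
Qed.

(** If [B] met every member of [U], then [U] and [B] would generate a strictly larger filter. *)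
Lemma ring_ultrafilter_disjoint U B :
  (forall B C, A B -> A C -> A (B `&` C)) -> ring_ultrafilter A U ->
  A B -> ~ U B -> exists2 C, U C & C `&` B = set0.
Proof.
move=> AI [[UA [C0 UC0] U0 UI Uup] Umax] AB UB; apply: contrapT => sep; apply: UB.
have meetB C : U C -> C `&` B <> set0 by move=> UC CB; apply: sep; exists C.
suff <- : [set C | A C /\ exists2 G, U G & G `&` B `<=` C] = U.
  by split=> //; exists C0.
apply: Umax => [|C UC]; last by split; [exact: UA | exists C => // x []].
split=> [C []//||[_ [G UG]]||].
- by exists B; split=> //; exists C0.
- by rewrite subset0; exact: meetB.
- move=> C C' [AC [G UG GC]] [AC' [G' UG' GC']]; split; first exact: AI.
  exists (G `&` G'); first exact: UI.
  by move=> x [[Gx G'x] Bx]; split; [apply: GC | apply: GC'].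
- move=> C C' AC' [AC [G UG GC]] CC'; split=> //; exists G => //.
  exact: subset_trans CC'.
Qed.

(** Primeness: otherwise each [B] in [D] misses some member of [U], and finitely many such members
    intersect in one that misses [C]. *)
Lemma ring_ultrafilter_bigcup U D C :
  (forall B C, A B -> A C -> A (B `&` C)) -> ring_ultrafilter A U ->
  finite_set D -> D `<=` A -> U C -> C `<=` \bigcup_(B in D) B ->
  exists2 B, D B & U B.
Proof.
move=> AI uU finD DA UC CD; apply: contrapT => noB.
have [[UA _ U0 UI _] _] := uU.
have [|G UG GD] := ring_filter_disjoint uU.1 finD.
  move=> B DB; apply: ring_ultrafilter_disjoint => //; first exact: DA.
  by move=> UB; apply: noB; exists B.
apply: U0; suff <- : G `&` C = set0 by exact: UI.
by rewrite -subset0 -GD; apply: setIS.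
Qed.

End RingFilterTheory.

(** * The ring [ringA] and the ultrafilters of vertices and infinite paths *)

Section Ring.
Variables (T : digraph) (treeT : is_tree T).
Implicit Types (u v w x y m : vertex T) (e f : edge T) (F G : set (edge T)).
Implicit Types (B C : set (vertex T)).

Lemma ringA_VsetF u F : fin_sub u F -> ringA (VsetF u F).
Proof.
move=> finF; exists 1, (fun=> u), (fun=> F); split=> //.
  by move=> i j _ _ _; rewrite !ord1.
by apply/seteqP; split=> [v uv|v [i _]//]; exists ord0.
Qed.

Lemma ringA_Vset u : ringA (Vset u).
Proof. by rewrite -VsetF0; apply: ringA_VsetF; exact: fin_sub0. Qed.

(** Empty pieces must be discarded, since no [VsetF v F] is empty; the other indices are
    renumbered. *)
Lemma ringA_bigcup (I : finType) (K : I -> set (vertex T)) :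
  (forall i, K i !=set0 -> exists v F, fin_sub v F /\ K i = VsetF v F) ->
  trivIset setT K -> ringA (\bigcup_i K i).
Proof.
move=> KV Ktriv; pose J := [set i | `[< K i !=set0 >]]%SET.
have JV (k : 'I_#|J|) : exists vF : vertex T * set (edge T),
    fin_sub vF.1 vF.2 /\ K (enum_val k) = VsetF vF.1 vF.2.
  have := enum_valP k; rewrite inE => /asboolP/KV[v [F [finF KE]]].
  by exists (v, F).
have [vF vFP] := choice JV.
exists #|J|, (fst \o vF), (snd \o vF); split=> [k| |].
- by have [] := vFP k.
- move=> k l _ _; rewrite /= -(vFP k).2 -(vFP l).2 => /Ktriv kl.
  by apply: enum_val_inj; apply: kl.
- apply/seteqP; split=> v.
    move=> [i _ Kiv]; have Ji : i \in J by rewrite inE; apply/asboolP; exists v.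
    exists (enum_rank_in Ji i) => //=.
    by rewrite -(vFP _).2 enum_rankK_in.
  by move=> [k _ /=]; rewrite -(vFP _).2 => Kv; exists (enum_val k).
Qed.

Lemma ringAI B C : ringA B -> ringA C -> ringA (B `&` C).
Proof.
move=> [n [v [F [finF trF ->]]]] [n' [w [G [finG trG ->]]]].
pose K (ij : 'I_n * 'I_n') :=
  VsetF (v ij.1) (F ij.1) `&` VsetF (w ij.2) (G ij.2).
suff -> : \bigcup_i VsetF (v i) (F i) `&` \bigcup_j VsetF (w j) (G j) =
          \bigcup_ij K ij.
  apply: ringA_bigcup => [[i j]|[i j] [i' j'] _ _ [x [[/= ? ?] [/= ? ?]]]].
    exact: VsetFI.
  by congr pair; [apply: trF | apply: trG] => //; exists x.
apply/seteqP; split=> x; first by move=> [[i _ ?] [j _ ?]]; exists (i, j).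
by move=> [[i j] _ [/= ? ?]]; split; [exists i | exists j].
Qed.

(** A set in a larger filter is a finite union of basic sets, so either one of its pieces lies in
    [U] or a member of [U] misses all of it. *)
Lemma ring_ultrafilterA (U : set (set (vertex T))) : ring_filter (@ringA T) U ->
  (forall w G, fin_sub w G -> U (VsetF w G) \/
     exists2 C, U C & C `&` VsetF w G = set0) ->
  ring_ultrafilter (@ringA T) U.
Proof.
move=> fU decU; split=> // U' [U'A _ U'0 U'I _] UU'.
apply/seteqP; split=> // B U'B.
have [n [v [F [finF trF BE]]]] := U'A _ U'B.
have [[i UVi]|noV] := pselect (exists i, U (VsetF (v i) (F i))).
  have [_ _ _ _ Uup] := fU; apply: Uup UVi _; first exact: U'A.
  by rewrite BE => x; exists i.
have [||C UC CV] := ring_filter_disjoint fU (D := range (fun i => VsetF (v i) (F i))).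
- exact: finite_image.
- by move=> _ [i _ <-]; have [UVi|//] := decU _ _ (finF i); case: noV; exists i.
case: U'0; rewrite -CV bigcup_image -BE.
by apply: U'I => //; exact: UU'.
Qed.

Lemma vertex_ultrafilter v : ring_ultrafilter (@ringA T) (vertex_family v).
Proof.
apply: ring_ultrafilterA => [|w G finG].
  split=> [B []//||[]//|B C [AB Bv] [AC Cv]|B C AC [AB Bv] BC].
  - by exists (Vset v); split; [exact: ringA_Vset | exact: Vset_refl].
  - by split; [exact: ringAI | ].
  - by split=> //; apply: BC.
have [wv|nwv] := pselect (VsetF w G v); [left|right].
  by split=> //; exact: ringA_VsetF.
have [vw0|/eqP/set0P[x [vx wx]]] := pselect (Vset v `&` VsetF w G = set0).
  by exists (Vset v) => //; split; [exact: ringA_Vset | exact: Vset_refl].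
have wx' : Vset w x by rewrite -VsetF0; apply: VsetFS wx.
(* If [a] is empty, [b] leads from [w] to [v] and puts [v] in [VsetF w G]. Otherwise all common
   points are reached from [v] through [e], so excluding [e] separates. *)
have [m [[|e a] [b [va wb meet]]]] := Vset_meet treeT vx wx'.
  case: nwv; apply/VsetFP; exists b; first by rewrite va.
  move/VsetFP: wx vx => [q wq Gq] /VsetP[p vp].
  by have [c [_ qE _]] := meet _ _ _ vp wq; move: Gq; rewrite qE; case: b {wb meet qE}.
exists (VsetF v [set e]).
  split; last exact: VsetF_refl.
  by apply: ringA_VsetF; split=> // f ->; case: va.
apply/seteqP; split=> // y [/VsetFP[p vp ep] /VsetFP[q wq _]].
by have [c [pE _ _]] := meet _ _ _ vp wq; rewrite pE in ep; exact: ep.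
Qed.

Lemma dwalk_infpath (p : nat -> edge T) i k : is_infpath p -> (forall i, pos (p i)) ->
  dwalk (org (p i)) (map p (iota i k)) (org (p (i + k))).
Proof.
move=> pinf ppos; elim: k i => [|k IH] i /=; first by rewrite addn0.
by split=> //; have [-> _] := pinf i; rewrite addnS -addSn; exact: IH.
Qed.

Lemma path_ultrafilter (p : nat -> edge T) : is_infpath p ->
  (forall i, pos (p i)) -> ring_ultrafilter (@ringA T) (path_family p).
Proof.
move=> pinf ppos.
have pS i k : Vset (org (p (i + k))) `<=` Vset (org (p i)).
  by apply: Vset_trans; apply/VsetP; exists (map p (iota i k)); exact: dwalk_infpath.
have pV i : path_family p (Vset (org (p i))).
  by split; [exact: ringA_Vset | exists i].
apply: ring_ultrafilterA => [|w G finG].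
  split=> [B []//||[_ [j]]|B C [AB [i Bi]] [AC [j Cj]]|B C AC [AB [i Bi]] BC].
  - by exists (Vset (org (p 0))).
  - by move/(_ _ (Vset_refl (org (p j)))).
  - split; first exact: ringAI.
    exists (i + j); rewrite subsetI; split; first exact: subset_trans Bi.
    by rewrite addnC; apply: subset_trans Cj.
  - by split=> //; exists i; exact: subset_trans BC.
apply: contrapT => /not_orP[nU nsep].
have meetV i : Vset (org (p i)) `&` VsetF w G !=set0.
  by apply/set0P/eqP => pw0; apply: nsep; exists (Vset (org (p i))).
have [x [px wx]] := meetV 0.
have wx' : Vset w x by rewrite -VsetF0; apply: VsetFS wx.
have [m [a [b [va wb meet]]]] := Vset_meet treeT px wx'.
(* The path [p] reaches [m] after [k] edges. Sampling at [k.+1] fixes the next edge [p k], so the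
   walk from [w] has a known first edge even when [b] is empty. *)
set k := size a.
have [z [/VsetP[c zc] /VsetFP[q wq Gq]]] := meetV k.+1.
have seg : dwalk (org (p 0)) (map p (iota 0 k) ++ p k :: c) z.
  rewrite -cat_rcons -map_rcons; have -> : rcons (iota 0 k) k = iota 0 k.+1.
    by rewrite -cats1 -addn1 iotaD.
  by apply/dwalk_cat; exists (org (p k.+1)) => //; exact: dwalk_infpath.
have [d [/(congr1 (drop k)) + qE md]] := meet _ _ _ seg wq.
rewrite drop_size_cat ?drop_size_cat ?size_map ?size_iota // => dE.
rewrite -dE in qE md.
apply: nU; split; first exact: ringA_VsetF.
exists k.+1 => y /VsetP[c' yc']; apply/VsetFP; exists (b ++ p k :: c').
  apply/dwalk_cat; exists m => //=; split; first by case: md.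
  by have [-> _] := pinf k.
by move: Gq; rewrite qE; case: (b).
Qed.

Lemma infpath_choice (P : vertex T -> Prop) u :
  (forall v, P v -> exists2 e, Delta1 v e & P (tgt e)) -> P u ->
  exists p, [/\ is_infpath p, forall i, pos (p i), org (p 0) = u &
                forall i, P (org (p i))].
Proof.
move=> Pstep Pu; have [e0 _ _] := Pstep _ Pu.
(* [e0] is a default edge for vertices outside [P], which the iteration never visits. *)
have /choice[f fP] : forall v, exists e, P v -> Delta1 v e /\ P (tgt e).
  move=> v; have [/Pstep[e ve Pe]|nPv] := pselect (P v); last by exists e0.
  by exists e.
pose s n := iter n (fun v => tgt (f v)) u.
have Ps n : P (s n) by elim: n => //= n /fP[].
have sE n : org (f (s n)) = s n by have [[]] := fP _ (Ps n).
have fpos n : pos (f (s n)) by have [[]] := fP _ (Ps n).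
exists (f \o s); split=> // [i||i]; [|exact: (sE 0)|by rewrite /= sE].
split; first exact: (esym (sE i.+1)).
by move=> fE; have := fpos i.+1; rewrite [f (s i.+1)]fE pos_rev; apply; exact: fpos.
Qed.

End Ring.

(** * Points of the spectrum and of the boundary *)

Section Spectrum.
Variables (T : digraph) (treeT : is_tree T).
Implicit Types (u v w : vertex T) (e f : edge T) (F G : set (edge T)).
Implicit Types (B C : set (vertex T)) (x : spectrum T) (W : set (spectrum T)).

Lemma open_cyl B : ringA B -> open (cyl B).
Proof.
by move=> AB; exists [set B]; [move=> _ -> | rewrite bigcup_set1].
Qed.

Lemma spectrum_base W x : open W -> W x ->
  exists B, [/\ ringA B, cyl B x & cyl B `<=` W].
Proof.
move=> [D DA <-] [B DB Bx]; exists B; split=> //; first exact: DA.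
by move=> y By; exists B.
Qed.

Lemma cyl_ringA B x : cyl B x -> ringA B.
Proof. by have [[UA _ _ _ _] _] := ufamP x; exact: UA. Qed.

Lemma cylS B C : ringA C -> B `<=` C -> cyl B `<=` cyl C.
Proof.
by move=> AC BC x Bx; have [[_ _ _ _ Uup] _] := ufamP x; exact: Uup BC.
Qed.

Lemma bcylS B C : ringA C -> B `<=` C -> bcyl B `<=` bcyl C.
Proof. by move=> AC BC; apply: setSI; exact: cylS. Qed.

Lemma cyl_bigcup x (D : set (set (vertex T))) C : finite_set D ->
  D `<=` @ringA T -> cyl C x -> C `<=` \bigcup_(B in D) B ->
  exists2 B, D B & cyl B x.
Proof. by apply: ring_ultrafilter_bigcup; [exact: ringAI | exact: ufamP]. Qed.

Lemma vertex_point v : exists x, ufam x = vertex_family v.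
Proof. by exists (Spectrum (vertex_ultrafilter treeT v)). Qed.

Lemma path_point (p : nat -> edge T) : is_infpath p -> (forall i, pos (p i)) ->
  exists2 x, boundary x & ufam x = path_family p.
Proof.
move=> pinf ppos; exists (Spectrum (path_ultrafilter treeT pinf ppos)) => //.
by apply: subset_closure; right; exists p.
Qed.

Lemma boundary_dense B x : boundary x -> cyl B x ->
  (exists2 v, Omega v & B v) \/
  (exists p, [/\ is_infpath p, forall i, pos (p i) &
                 exists j, Vset (org (p j)) `<=` B]).
Proof.
move=> bx Bx; have /bx[y []] : nbhs x (cyl B).
  by apply: open_nbhs_nbhs; split=> //; apply: open_cyl; exact: cyl_ringA Bx.
rewrite /cyl /= => -[[v Ov ->]|[p [pinf ppos ->]]] []; first by left; exists v.
by right; exists p.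
Qed.

(** Either a sink lies below [u], or a directed path from [u] can be continued forever. *)
Lemma boundary_cyl_Vset u : exists2 x, boundary x & cyl (Vset u) x.
Proof.
have [[v uv Ov]|noO] := pselect (exists2 v, Vset u v & Omega v).
  have [x xE] := vertex_point v; exists x.
    by apply: subset_closure; left; exists v.
  by rewrite /cyl /= xE; split=> //; exact: ringA_Vset.
have [|p [pinf ppos p0 _]] := infpath_choice (P := Vset u) _ (Vset_refl u).
  move=> v uv; have [v0|/eqP/set0P[e ve]] := pselect (Delta1 v = set0).
    by case: noO; exists v.
  by exists e => //; apply: Vset_trans uv _ (Vset_edge ve).
have [x bx xE] := path_point pinf ppos; exists x => //.
by rewrite /cyl /= xE; split; [exact: ringA_Vset | exists 0; rewrite p0].
Qed.

(** A sink is a boundary point by definition. If [Delta1 u] is infinite, each ring set around [u]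
    contains some [Vset (tgt e)], hence a boundary point, so [u] is a limit of such points. *)
Lemma not_Sigma_boundary u x : ~ Sigma u -> ufam x = vertex_family u -> boundary x.
Proof.
move=> nS xE; have [u0|/eqP/set0P[e0 ue0]] := pselect (Delta1 u = set0).
  by apply: subset_closure; left; exists u.
have infu : ~ finite_set (Delta1 u) by move=> finu; apply: nS; split=> //; exists e0.
move=> O; rewrite nbhsE => -[O' [oO' O'x] O'O].
have [B [AB Bx BO']] := spectrum_base oO' O'x.
suff [e ue eB] : exists2 e, Delta1 u e & Vset (tgt e) `<=` B.
  have [y by_ ey] := boundary_cyl_Vset (tgt e).
  have [z [zD zO]] : _ := by_ _ (open_nbhs_nbhs (conj (open_cyl (ringA_Vset (tgt e))) ey)).
  by exists z; split=> //; apply/O'O/BO'; exact: cylS zO.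
move: (Bx); rewrite /cyl /= xE => -[_]; have [n [v [F [finF _ BE]]]] := AB.
(* If [u] is the root of piece [i], an edge outside the finite [F i] works; otherwise the piece
   contains all of [Vset u] and any edge does. *)
rewrite BE => -[i _ iu]; have [uE|nuE] := pselect (u = v i); last first.
  exists e0 => //; apply: subset_trans (Vset_trans (Vset_edge ue0)) _.
  by apply: subset_trans (VsetF_Vset iu nuE) _ => y; exists i.
have [e ue Fe] : exists2 e, Delta1 u e & ~ F i e.
  apply: contrapT => noe; apply: infu; apply: sub_finite_set (finF i).1 => e ue.
  by apply: contrapT => Fe; apply: noe; exists e.
exists e => //; rewrite uE in ue.
by apply: subset_trans (sub_VsetF ue Fe) _ => y; exists i.
Qed.

(** The singleton of [u] is a ring set since [Delta1 u] is finite, and its cylinder misses the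
    boundary: [u] is not a sink, and no infinite directed path stays at [u]. *)
Lemma bcyl_Sigma u F : Sigma u -> fin_sub u F ->
  bcyl (VsetF u F) `<=` \bigcup_(e in Delta1 u `\` F) bcyl (Vset (tgt e)).
Proof.
move=> [[e0 ue0] finu] finF x [Fx bx].
have [|||B [->|[e ue <-]] Bx] := @cyl_bigcup x
    ([set VsetF u (Delta1 u)] `|` [set Vset (tgt e) | e in Delta1 u `\` F]) _ _ _ Fx.
- rewrite finite_setU; split; first exact: finite_set1.
  by apply: finite_image; exact: sub_finite_set finu.
- move=> _ [->|[e _ <-]]; last exact: ringA_Vset.
  by apply: ringA_VsetF; split.
- move=> y [->|[e ue ey]].
    by exists (VsetF u (Delta1 u)); [left | left].
  by exists (Vset (tgt e)) => //; right; exists e.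
- have := boundary_dense bx Bx; rewrite VsetF_Delta1 => -[[v Ov vu]|].
    by move: Ov; rewrite vu /Omega /= => u0; rewrite u0 in ue0.
  move=> [p [pinf ppos [j jS]]].
  have pj : org (p j) = u := jS _ (Vset_refl _).
  have uj : Delta1 u (p j) by split.
  by case: (tgt_neq treeT uj); apply: jS; apply: Vset_edge; split.
- by exists e.
Qed.

End Spectrum.

Section Invariants.
Variables (T : digraph) (treeT : is_tree T).
Implicit Types (u v w : vertex T) (e f : edge T) (F G : set (edge T)).
Implicit Types (W : set (spectrum T)).

(** * From open sets to invariants *)

Section FromOpen.
Variable W : set (spectrum T).

Lemma LN_ex u : LN W u -> exists2 F, fin_sub u F & bcyl (VsetF u F) `<=` W.
Proof.
move=> [[_ //]|uW]; exists set0; first exact: fin_sub0.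
by rewrite VsetF0.
Qed.

Lemma fin_sub_LF u : LN W u -> fin_sub u (LF W u).
Proof.
move=> Nu; have [F [finF Fu] FW] := LN_ex Nu.
have LFF : LF W u `<=` F by move=> e [_]; apply.
by split; [exact: sub_finite_set finF | exact: subset_trans Fu].
Qed.

Lemma not_LF u e : LN W u -> ~ LF W u e ->
  exists F, [/\ fin_sub u F, bcyl (VsetF u F) `<=` W & ~ F e].
Proof.
move=> Nu nLF; apply: contrapT => noF; apply: nLF; split=> // F finF FW.
by apply: contrapT => Fe; apply: noF; exists F.
Qed.

Lemma LF_edge u e : LN W u -> Delta1 u e -> ~ LF W u e ->
  bcyl (Vset (tgt e)) `<=` W.
Proof.
move=> Nu ue /(not_LF Nu)[F [finF FW Fe]]; apply: subset_trans FW.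
by apply: bcylS; [exact: ringA_VsetF | exact: sub_VsetF].
Qed.

(* [LF W u] itself belongs to the family whose intersection it is: compared
   with a member [F], it only adds the finitely many sets [Vset (tgt e)] with
   [e] in [F] but not in [LF W u]. *)
Lemma LF_sub u : LN W u -> bcyl (VsetF u (LF W u)) `<=` W.
Proof.
move=> Nu x [ux bx]; have [F finF FW] := LN_ex Nu.
have [|||B [->|[e [Fe ne] <-]] Bx] := @cyl_bigcup _ treeT x
    ([set VsetF u F] `|` [set Vset (tgt e) | e in F `\` LF W u]) _ _ _ ux.
- rewrite finite_setU; split; first exact: finite_set1.
  by apply: finite_image; apply: sub_finite_set finF.1 => e [].
- by move=> _ [->|[e _ <-]]; [exact: ringA_VsetF | exact: ringA_Vset].
- move=> y [->|[e [ue ne] ey]].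
    by exists (VsetF u F); left.
  have [Fe|Fe] := pselect (F e).
    by exists (Vset (tgt e)) => //; right; exists e.
  by exists (VsetF u F); [left | exact: sub_VsetF ey].
- by apply: FW; split.
- by apply: (@LF_edge u e) => //; exact: finF.2.
Qed.

Lemma LF_Vset u : LN W u -> bcyl (Vset u) `<=` W -> LF W u = set0.
Proof.
move=> Nu uW; rewrite -subset0 => e [_ /(_ set0)]; apply; first exact: fin_sub0.
by rewrite VsetF0.
Qed.

Lemma Vset_LN u : bcyl (Vset u) `<=` W -> LN W u /\ LF W u = set0.
Proof. by move=> uW; have Nu : LN W u := or_intror uW; split=> //; exact: LF_Vset. Qed.

Lemma LN_Vset u : LN W u -> LF W u = set0 -> bcyl (Vset u) `<=` W.
Proof. by move=> /LF_sub + uF; rewrite uF VsetF0. Qed.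

Lemma Lmap_inv : invI T (Lmap T W).
Proof.
split=> [u Nu|]; first by rewrite -subset0 => e [/Nu].
split=> [u|u Nu finu|u e Nu ue Fe|u e Nu ue [_ LFe] Ne Fe0|u finu [e0 ue0] Hu].
- exact: fin_sub_LF.
- have [[nS _]|uW] : _ \/ bcyl (Vset u) `<=` W := Nu; last exact: LF_Vset.
  rewrite -subset0; have <- : Delta1 u = set0; last exact: (fin_sub_LF Nu).2.
  by apply: contrapT => /eqP/set0P u0; case: nS.
- by apply: Vset_LN; exact: (LF_edge Nu).
(* If [Vset (tgt e)] is covered as well, then [e] can be removed from [LF W u], against its
   minimality. *)
- have teW := LN_Vset Ne Fe0.
  have finLF := fin_sub_LF Nu.
  have finLFe : fin_sub u (LF W u `\ e).
    split; first by apply: sub_finite_set finLF.1 => f [].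
    by apply: subset_trans finLF.2 => f [].
  suff sW : bcyl (VsetF u (LF W u `\ e)) `<=` W.
    by have [_] := LFe _ finLFe sW; apply.
  move=> x [ux bx].
  have [|||B [->|->] Bx] := @cyl_bigcup _ treeT x
      [set VsetF u (LF W u); Vset (tgt e)] _ _ _ ux.
  + exact: finite_set2.
  + by move=> _ [->|->]; [exact: ringA_VsetF | exact: ringA_Vset].
  + move=> y [->|[f [uf nf] fy]].
      by exists (VsetF u (LF W u)); [left | left].
    have [ef|nef] := pselect (f = e).
      by exists (Vset (tgt e)); [right | rewrite -ef].
    exists (VsetF u (LF W u)); first by left.
    by apply: sub_VsetF fy => // LFf; apply: nf.
  + by apply: (LF_sub Nu); split.
  + by apply: teW; split.
- right => x; rewrite /= -VsetF0 => /(bcyl_Sigma treeT).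
  case=> [||e [ue _] ex]; [by split; first by exists e0 | exact: fin_sub0 |].
  by have [Ne Fe] := Hu _ ue; exact: (LN_Vset Ne Fe).
Qed.

Lemma Ubd_Lmap : openJ T W -> Ubd T (Lmap T W) = W.
Proof.
move=> [O oO WE]; apply/seteqP; split; first by move=> x [u Nu]; exact: LF_sub.
move=> x; rewrite {1}WE => -[Ox bx].
have [B [[n [v [F [finF trF BE]]]] Bx BO]] := spectrum_base oO Ox.
have [|||B' [i _ <-] ix] := @cyl_bigcup _ treeT x
    (range (fun i => VsetF (v i) (F i))) _ _ _ Bx.
- exact: finite_image.
- by move=> _ [i _ <-]; exact: ringA_VsetF.
- by rewrite bigcup_image BE.
have iW : bcyl (VsetF (v i) (F i)) `<=` W.
  rewrite WE => y [iy by_]; split=> //; apply: BO; apply: cylS iy => //.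
    by exists n, v, F.
  by rewrite BE => z; exists i.
(* A vertex of [Sigma] enters [LN W] only with its full [Vset], so the point is then covered from
   the target of an edge; outside [Sigma], [F i] witnesses membership. *)
have [Si|nSi] := pselect (Sigma (v i)).
  have [e [ve Fe] [ex _]] := bcyl_Sigma treeT Si (finF i) (conj ix bx).
  have teW : bcyl (Vset (tgt e)) `<=` W.
    by apply: subset_trans iW; apply: bcylS; [exact: ringA_VsetF | exact: sub_VsetF].
  by have [Ne Fe0] := Vset_LN teW; exists (tgt e) => //=; rewrite Fe0 VsetF0; split.
have Ni : LN W (v i) by left; split=> //; exists (F i).
exists (v i) => //; split=> //; apply: cylS ix.
  exact: ringA_VsetF (fin_sub_LF Ni).
by apply: VsetFS => e [_]; apply.
Qed.

End FromOpen.

(** * From invariants to open sets *)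

Section FromInvariant.
Variables (N : set (vertex T)) (F : vertex T -> set (edge T)).
Hypothesis invNF : invI T (N, F).

Let F_out u : ~ N u -> F u = set0. Proof. by case: invNF => /(_ u). Qed.
Let F_fin u : N u -> fin_sub u (F u).
Proof. by case: invNF => _ [/(_ u)]. Qed.

Lemma Ubd_open : openJ T (Ubd T (N, F)).
Proof.
exists (\bigcup_(u in N) cyl (VsetF u (F u))); last by rewrite setI_bigcupl.
apply: bigcup_open => u Nu; apply: open_cyl; apply: ringA_VsetF.
exact: F_fin.
Qed.

(** Once the first edge avoids [F w], every later vertex of the walk has empty [F], so [step]
    applies to each further edge. *)
Lemma invI_VsetF w v : N w -> VsetF w (F w) v -> v <> w -> N v /\ F v = set0.
Proof.
have [_ [_ _ step _ _]] := invNF.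
move=> Nw [//|[e [we Fe] /VsetP[p pv]]] _.
have := step _ _ Nw we Fe; elim: p (tgt e) pv {we Fe} => [|f p IH] u /=.
  by move=> <-.
move=> [uf pv] [Nu Fu]; apply: (IH _ pv); apply: (step u) => //.
by rewrite Fu.
Qed.

(** The vertex [u] is itself a boundary point, so it lies in some [VsetF w (F w)] with [w] in [N],
    as [w] or properly below it. *)
Lemma Ubd_not_Sigma u G : ~ Sigma u -> fin_sub u G ->
  bcyl (VsetF u G) `<=` Ubd T (N, F) -> N u.
Proof.
move=> nS finG uW; have [x xE] := vertex_point treeT u.
have [|w /= Nw [wx _]] := uW x.
  split; last exact: (not_Sigma_boundary treeT nS).
  by rewrite /cyl /= xE; split; [exact: ringA_VsetF | exact: VsetF_refl].
move: wx; rewrite /cyl /= xE => -[_ wu].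
by have [->//|nuw] := pselect (u = w); case: (invI_VsetF Nw wu nuw).
Qed.

Lemma Ubd_Vset u : bcyl (Vset u) `<=` Ubd T (N, F) -> N u /\ F u = set0.
Proof.
have [_ [_ _ _ Fne Nup]] := invNF.
pose good v := N v /\ F v = set0.
move=> uW; apply: contrapT => nu.
pose bad v := bcyl (Vset v) `<=` Ubd T (N, F) /\ ~ good v.
have edgeW v e : bcyl (Vset v) `<=` Ubd T (N, F) -> Delta1 v e ->
    bcyl (Vset (tgt e)) `<=` Ubd T (N, F).
  move=> vW ve; apply: subset_trans vW; apply: bcylS; first exact: ringA_Vset.
  exact: Vset_trans (Vset_edge ve).
have [||p [pinf ppos p0 pbad]] := @infpath_choice _ bad u _ _; last 1 first.
- have [x bx xE] := path_point treeT pinf ppos.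
  have [|w /= Nw] := uW x.
    split=> //; rewrite /cyl /= xE; split; first exact: ringA_Vset.
    by exists 0; rewrite p0.
  rewrite /bcyl /cyl /= xE => -[[_ [j jS]] _].
  (* Bad vertices in the tail can only be [w], yet two consecutive vertices of the path are bad and
     distinct. *)
  have at_w v : Vset (org (p j)) v -> bad v -> v = w.
    move=> jv [_ nv]; apply: contrapT => vw; apply: nv.
    exact: invI_VsetF Nw (jS _ jv) vw.
  have pj : Delta1 (org (p j)) (p j) by split.
  apply: (tgt_neq treeT pj); rewrite (at_w (org (p j))) //; last exact: Vset_refl.
  apply: at_w; first exact: Vset_edge.
  by have [-> _] := pinf j.
- move=> v [vW nv]; apply: contrapT => nobad.
  (* With only good targets [v] would be good: [Nup] or [Ubd_not_Sigma] puts it in [N], and [Fne]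
     leaves no edge in [F v]. *)
  have child e : Delta1 v e -> good (tgt e).
    move=> ve; apply: contrapT => ne; apply: nobad; exists e => //; split=> //.
    exact: edgeW ve.
  have Nv : N v.
    have [[ve finv]|nS] := pselect (Sigma v); first exact: Nup.
    by apply: (Ubd_not_Sigma nS (@fin_sub0 _ v)); rewrite VsetF0.
  apply: nv; split=> //; rewrite -subset0 => e Fe.
  have ve : Delta1 v e by exact: (F_fin Nv).2.
  by have [Ne Fe0] := child _ ve; exact: (Fne _ _ Nv ve Fe Ne).
- by split.
Qed.

Lemma LN_Ubd : LN (Ubd T (N, F)) = N.
Proof.
have [_ [_ F0 _ _ _]] := invNF.
apply/seteqP; split=> u.
  by move=> [[nS [G finG]]|/Ubd_Vset[]]; [exact: Ubd_not_Sigma|].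
move=> Nu; have uW : bcyl (VsetF u (F u)) `<=` Ubd T (N, F) by move=> x ux; exists u.
have [[_ finu]|nS] := pselect (Sigma u).
  by right; rewrite /= -VsetF0 -(F0 u).
by left; split=> //; exists (F u) => //; exact: F_fin.
Qed.

Lemma LF_Ubd u : LF (Ubd T (N, F)) u = F u.
Proof.
have [_ [_ _ _ Fne _]] := invNF.
have [Nu|nNu] := pselect (N u); last first.
  by rewrite F_out // -subset0 => e []; rewrite LN_Ubd.
apply/seteqP; split=> e.
  by move=> [_]; apply; [exact: F_fin | move=> x ux; exists u].
move=> Fe; split; first by rewrite LN_Ubd.
(* If [G] misses [e], then [Vset (tgt e)] is covered, so [tgt e] is in [N] with empty [F], which
   [Fne] forbids. *)
move=> G finG GW; apply: contrapT => nGe.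
have ue : Delta1 u e by exact: (F_fin Nu).2.
have [|Ne Fe0] := @Ubd_Vset (tgt e); last exact: (Fne _ _ Nu ue Fe Ne).
apply: subset_trans GW; apply: bcylS; first exact: ringA_VsetF.
exact: sub_VsetF.
Qed.

End FromInvariant.

End Invariants.

Theorem theorem1p28 (T : digraph) (treeT : is_tree T) :
  [/\ set_fun (openJ T) (invI T) (Lmap T),
      set_fun (invI T) (openJ T) (Ubd T),
      (forall W, openJ T W -> Ubd T (Lmap T W) = W) &
      (forall NF, invI T NF -> Lmap T (Ubd T NF) = NF)].
Proof.
split=> [W _|[N F] /Ubd_open|W|[N F] invNF] //; first exact: Lmap_inv.
  exact: Ubd_Lmap.
rewrite /Lmap LN_Ubd //; congr pair; apply/funext => u; exact: LF_Ubd.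
Qed.
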